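(* Let $K$ be an irreducible and reversible Markov kernel on a finite set $\mathcal X$ with stationary probability measure $\pi$, and let $\lambda>0$. Assume that $K$ satisfies the modified Talagrand inequality with constant $\lambda$: $\mathcal W(\rho,\mathbf 1)\le\sqrt{\frac2\lambda\mathcal H(\rho)}$ for all $\rho\in\mathscr P(\mathcal X)$, where $\mathbf 1$ is the density identically equal to $1$. Then for all $\rho\in\mathscr P(\mathcal X)$ $$W_{1,g}(\rho,\mathbf 1)\le\sqrt{\frac1\lambda\mathcal H(\rho)} .$$ Furthermore, $$\mathbb E_\pi\big[e^{t(\varphi-\mathbb E_\pi[\varphi])}\big]\le\exp\Big(\frac{t^2}{4\lambda}\Big)$$ for all $t>0$ and every function $\varphi:\mathcal X\to\mathbb R$ that is $1$-Lipschitz with respect to the graph distance on $\mathcal X$.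
   Context: $\mathbb R_+=[0,\infty)$. Markov kernel: $K:\mathcal X\times\mathcal X\to\mathbb R_+$, $\sum_yK(x,y)=1$; reversible: $K(x,y)\pi(x)=K(y,x)\pi(y)$. $\mathscr P(\mathcal X)=\{\rho:\mathcal X\to\mathbb R_+ : \sum_x\pi(x)\rho(x)=1\}$. $\theta$ is the logarithmic mean $\theta(s,t)=\int_0^1s^{1-p}t^p\,dp$ ($=0$ if $s=0$ or $t=0$); $\hat\rho(x,y)=\theta(\rho(x),\rho(y))$. Metric: $\mathcal W(\bar\rho_0,\bar\rho_1)^2=\inf\int_0^1\frac12\sum_{x,y}(\psi_t(y)-\psi_t(x))^2\hat\rho_t(x,y)K(x,y)\pi(x)\,dt$ over pairs $(\rho,\psi)$ with $\rho:[0,1]\to\mathbb R^{\mathcal X}$ of class $C^\infty$, $\rho_t\in\mathscr P(\mathcal X)$ for all $t$, $\rho_0=\bar\rho_0$, $\rho_1=\bar\rho_1$, $\psi:[0,1]\to\mathbb R^{\mathcal X}$ measurable, and $\dot\rho_t(x)+\sum_y(\psi_t(y)-\psi_t(x))\hat\rho_t(x,y)K(x,y)=0$ for all $x$, $t\in(0,1)$. $\mathcal H(\rho)=\sum_x\pi(x)\rho(x)\log\rho(x)$ ($0\log0=0$). $\mathbb E_\pi[\varphi]=\sum_x\varphi(x)\pi(x)$. The graph distance $d_g$ is the distance on the graph with vertex set $\mathcal X$ in which $\{x,y\}$ is an edge iff $K(x,y)>0$. $W_{1,g}(\rho_0,\rho_1)=\inf_q\sum_{x,y}d_g(x,y)q(x,y)$,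 the infimum over couplings $q:\mathcal X\times\mathcal X\to\mathbb R_+$ with $\sum_yq(x,y)=\rho_0(x)\pi(x)$ and $\sum_xq(x,y)=\rho_1(y)\pi(y)$. *)

(* Defs.v *)
From HB Require Import structures.
From mathcomp Require Export all_boot all_order all_algebra.
From mathcomp Require Export all_classical all_reals all_analysis.
Export Order.TTheory GRing.Theory Num.Theory.
Export numFieldNormedType.Exports.
Set Implicit Arguments.
Unset Strict Implicit.
Unset Printing Implicit Defensive.
Local Open Scope classical_set_scope.
Local Open Scope ring_scope.

Section MarkovKernel.
Context {R : realType} {X : finType}.
Implicit Types (K : X -> X -> R) (pi r : X -> R) (rho psi : R -> X -> R).

Definition markov_kernel K :=
  (forall x y, 0 <= K x y) /\ (forall x, \sum_y K x y = 1).

Definition edge K : rel X := fun x y => 0 < K x y.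

Definition irreducible K := forall x y, connect (edge K) x y.

Definition probability_measure pi :=
  (forall x, 0 <= pi x) /\ \sum_x pi x = 1.

Definition stationary K pi := forall y, \sum_x pi x * K x y = pi y.

Definition reversible K pi := forall x y, K x y * pi x = K y x * pi y.

Definition density pi r :=
  (forall x, 0 <= r x) /\ \sum_x pi x * r x = 1.

Definition logmean (s t : R) : R :=
  if (s == 0) || (t == 0) then 0
  else \int[lebesgue_measure]_(p in `[0, 1]) (s `^ (1 - p) * t `^ p).

Definition rhohat r x y := logmean (r x) (r y).

(* Class C^oo on the closed interval [0, 1]: derivatives of all orders exist
   in the interior and extend continuously to the endpoints, [d n] being the
   extended n-th derivative.  Values of [f] outside [0, 1] play no role. *)
Definition smooth01 (f : R -> R) :=
  exists d : nat -> R -> R,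
    d 0%N = f /\
    forall n, {within `[0, 1], continuous (d n)} /\
      (forall t : R, t \in `]0, 1[ -> is_derive t 1 (d n) (d n.+1 t)).

Definition admissible_curve K pi r0 r1 rho psi :=
  [/\ forall x, smooth01 (fun t => rho t x),
      forall t : R, t \in `[0, 1] -> density pi (rho t),
      rho 0 = r0 /\ rho 1 = r1,
      forall x, measurable_fun (`[0, 1] : set R) (fun t => psi t x) &
      forall (t : R) x, t \in `]0, 1[ ->
        derive1 (fun s => rho s x) t
        + \sum_y (psi t y - psi t x) * rhohat (rho t) x y * K x y = 0].

Definition action K pi rho psi : \bar R :=
  (\int[lebesgue_measure]_(t in `[0%R, 1%R])
     (2^-1 * \sum_x \sum_y
        (psi t y - psi t x) ^+ 2 * rhohat (rho t) x y * K x y * pi x)%R%:E)%E.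

Definition dist_W K pi r0 r1 : \bar R :=
  sqrte (ereal_inf [set action K pi c.1 c.2 |
    c in [set c | admissible_curve K pi r0 r1 c.1 c.2]]).

(* [ln 0 = 0], so that 0 log 0 = 0. *)
Definition entropy pi r : R := \sum_x pi x * r x * ln (r x).

Definition expect pi (phi : X -> R) : R := \sum_x phi x * pi x.

(* The set of lengths is nonempty for all x, y when K is irreducible; [edge K]
   is symmetric when K is reversible.  Loops do not affect the infimum. *)
Definition graph_dist K x y : R :=
  inf [set (size p)%:R | p in [set p | path (edge K) x p /\ last x p = y]].

Definition coupling pi r0 r1 (q : X -> X -> R) :=
  [/\ forall x y, 0 <= q x y,
      forall x, \sum_y q x y = r0 x * pi x &
      forall y, \sum_x q x y = r1 y * pi y].

Definition dist_W1g K pi r0 r1 : \bar R :=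
  ereal_inf [set (\sum_x \sum_y graph_dist K x y * q x y)%:E |
    q in [set q | coupling pi r0 r1 q]].

Definition lipschitz1 K (phi : X -> R) :=
  forall x y, `|phi x - phi y| <= graph_dist K x y.

Definition modified_talagrand K pi (lambda : R) :=
  forall r, density pi r ->
    (dist_W K pi r (fun=> 1%R) <= (Num.sqrt (2 / lambda * entropy pi r))%:E)%E.

End MarkovKernel.

(* Main.v *)
(* Along an admissible curve, mass crosses the edge (x, y) at the rate
   (psi(y) - psi(x)) rhohat(x, y) K(x, y) pi(x).  Integrated over time, these
   rates form an edge flow transporting r0 pi to r1 pi, of total cost at most
   the time integral of (1/2) sum |psi(y) - psi(x)| rhohat K pi.  Since the
   logarithmic mean is bounded by the arithmetic mean, sum rhohat K pi <= 1,
   and Cauchy-Schwarz bounds this cost by sqrt (action / 2).  A flow becomes a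
   coupling, without increasing its cost for a metric, by short-circuiting the
   vertices one after the other until each only sends or only receives; hence
   W_{1,g} <= W / sqrt 2, which gives the first claim.  The second one follows
   from the first by the Bobkov-Goetze argument. *)
Require Import Defs.
From mathcomp Require Import unstable measurable_realfun ring lra.
Set Implicit Arguments.
Unset Strict Implicit.
Unset Printing Implicit Defensive.
Local Open Scope classical_set_scope.
Local Open Scope ring_scope.

(** * Flows and couplings on a finite metric space *)

Section flow.
Context {R : realType} {X : finType}.
Variable d : X -> X -> R.
Hypothesis d0 : forall x, d x x = 0.
Hypothesis d_tri : forall x y z, d x z <= d x y + d y z.
Implicit Types (f g : X -> X -> R) (v : X).

Definition cost f := \sum_x \sum_y d x y * f x y.
Definition inflow f x := \sum_y f y x.
Definition outflow f x := \sum_y f x y.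
Definition pure f v := (forall y, f v y = 0) \/ (forall x, f x v = 0).

(** The preserved net balance fixes the transported marginals. The last clause allows vertices to be
    treated one at a time without spoiling those already done. *)
Definition reduces f g :=
  [/\ forall x y, 0 <= g x y,
      forall x, inflow g x - outflow g x = inflow f x - outflow f x,
      cost g <= cost f &
      forall v, pure f v -> pure g v].

Lemma reduces_trans f g h : reduces f g -> reduces g h -> reduces f h.
Proof.
move=> [_ fg2 fg3 fg4] [gh1 gh2 gh3 gh4]; split => //.
- by move=> x; rewrite gh2 fg2.
- exact: le_trans gh3 fg3.
- by move=> v /fg4/gh4.
Qed.

(** A loop adds equally to inflow and outflow and costs nothing. Loops must be cleared because
    [bypass] turns mass going from [x] to [v] and back into a loop at [x]. *)
Lemma reduces_loopless f : (forall x y, 0 <= f x y) ->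
  reduces f (fun x y => if x == y then 0 else f x y).
Proof.
move=> f0; split => [x y|x||v].
- by case: ifP.
- have -> : inflow (fun x y => if x == y then 0 else f x y) x =
      inflow f x - f x x.
    rewrite /inflow (bigD1 x)//= eqxx add0r [in RHS](bigD1 x)//= addrC addrK.
    by apply: eq_bigr => y /negbTE ->.
  have -> : outflow (fun x y => if x == y then 0 else f x y) x =
      outflow f x - f x x.
    rewrite /outflow (bigD1 x)//= eqxx add0r [in RHS](bigD1 x)//= addrC addrK.
    by apply: eq_bigr => y; rewrite eq_sym => /negbTE ->.
  lra.
- apply: ler_sum => x _; apply: ler_sum => y _.
  by case: eqP => [->|//]; rewrite d0 !mul0r.
- by case=> vf; [left|right] => x; rewrite vf; case: ifP.
Qed.

(* All flow through [v] is short-circuited: the amount [f x v * f v y / T]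
   that went from [x] to [y] via [v] now goes directly.  If [T = 0] there is
   no flow at [v] and division by zero is harmless. *)
Definition bypass f v x y :=
  let T := Num.max (inflow f v) (outflow f v) in
  f x y + f x v * f v y / T - (if y == v then f x v * (outflow f v / T) else 0)
  - (if x == v then f v y * (inflow f v / T) else 0).

(** Normalizing by the larger of inflow and outflow never removes more than is present, and removes
    everything on the smaller side. *)
Lemma reduces_bypass f v : (forall x y, 0 <= f x y) -> f v v = 0 ->
  reduces f (bypass f v) /\ pure (bypass f v) v.
Proof.
move=> f0 fvv; rewrite /bypass.
set I := inflow f v; set O := outflow f v; set T := Num.max I O.
have I0 : 0 <= I by apply: sumr_ge0.
have O0 : 0 <= O by apply: sumr_ge0.
have T0 : 0 <= T by rewrite le_max I0.
have T_case : T = 0 \/ 0 < T by move: T0; rewrite le_eqVlt => /predU1P[]; auto.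
have IT : I / T <= 1.
  have [Te|T_gt0] := T_case.
    by rewrite Te invr0 mulr0.
  by rewrite ler_pdivrMr// mul1r le_max lexx.
have OT : O / T <= 1.
  have [Te|T_gt0] := T_case.
    by rewrite Te invr0 mulr0.
  by rewrite ler_pdivrMr// mul1r le_max lexx orbT.
have TV0 : 0 <= T^-1 by rewrite invr_ge0.
split; first split.
- move=> x y; have [->|xv] := eqVneq x v; have [->|yv] := eqVneq y v.
  + by rewrite fvv !mul0r; lra.
  + rewrite fvv !mul0r; have := ler_wpM2l (f0 v y) IT; lra.
  + rewrite fvv mulr0 !mul0r; have := ler_wpM2l (f0 x v) OT; lra.
  + by rewrite !subr0 addr_ge0// !mulr_ge0.
(* For [x] other than [v] inflow and outflow are each unchanged; at [v] both drop by [I * O / T]. *)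
- move=> x; rewrite /inflow /outflow !sumrB !big_split/=.
  have E1 : \sum_y f y v * f v x / T = I / T * f v x.
    by rewrite -mulr_suml -mulr_suml mulrAC.
  have E2 : \sum_y f x v * f v y / T = O / T * f x v.
    by rewrite -mulr_suml -mulr_sumr [_ * O]mulrC mulrAC.
  have E3 : \sum_y (if y == v then f v x * (I / T) else 0) = f v x * (I / T).
    by rewrite -big_mkcond big_pred1_eq.
  have E4 : \sum_y (if y == v then f x v * (O / T) else 0) = f x v * (O / T).
    by rewrite -big_mkcond big_pred1_eq.
  have E5 : \sum_y (if x == v then f y v * (O / T) else 0) =
      if x == v then I * (O / T) else 0.
    by case: ifP => _; [rewrite -mulr_suml|rewrite big1].
  have E6 : \sum_y (if x == v then f v y * (I / T) else 0) =
      if x == v then O * (I / T) else 0.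
    by case: ifP => _; [rewrite -mulr_suml|rewrite big1].
  rewrite E1 E2 E3 E4 E5 E6; case: ifP => _; ring.
(* Each rerouted amount changes the cost by the factor [d x y - d x v - d v y], which the triangle
   inequality makes nonpositive. *)
- have E : cost (bypass f v) = cost f
      + (\sum_x \sum_y d x y * (f x v * f v y / T)
        - \sum_x \sum_y d x v * (f x v * f v y / T)
        - \sum_x \sum_y d v y * (f x v * f v y / T)).
    rewrite /cost.
    have -> : \sum_x \sum_y d x v * (f x v * f v y / T) =
        \sum_x \sum_y d x y * (if y == v then f x v * (O / T) else 0).
      apply: eq_bigr => x _; rewrite [in RHS](bigD1 v)//= eqxx.
      rewrite [X in _ = _ + X]big1 ?addr0 => [|y /negbTE ->]; last exact: mulr0.
      rewrite -mulr_sumr -mulr_suml -mulr_sumr; congr (_ * _).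
      by rewrite mulrA.
    have -> : \sum_x \sum_y d v y * (f x v * f v y / T) =
        \sum_x \sum_y d x y * (if x == v then f v y * (I / T) else 0).
      rewrite exchange_big [RHS]exchange_big/=; apply: eq_bigr => y _.
      rewrite [in RHS](bigD1 v)//= eqxx.
      rewrite [X in _ = _ + X]big1 ?addr0 => [|x /negbTE ->]; last exact: mulr0.
      rewrite -mulr_sumr -mulr_suml -mulr_suml; congr (_ * _).
      by rewrite [_ * f v y]mulrC mulrA.
    rewrite -!sumrB -big_split/=; apply: eq_bigr => x _.
    rewrite -!sumrB -big_split/=; apply: eq_bigr => y _.
    by rewrite /bypass -/I -/O -/T !mulrBr mulrDr !addrA.
  rewrite -/(bypass f v) E gerDl -!sumrB sumr_le0// => x _.
  rewrite -!sumrB sumr_le0// => y _.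
  rewrite -!mulrBl mulr_le0_ge0 ?mulr_ge0//.
  by have := d_tri x v y; lra.
- move=> w [] fw; [left|right] => x.
    rewrite !fw !mul0r if_same; case: eqP => [wv|_];
      last by rewrite !subr0 addr0.
    by rewrite -wv fw mul0r !subr0 addr0.
  rewrite !fw mulr0 !mul0r if_same; case: eqP => [wv|_];
      last by rewrite !subr0 addr0.
  by rewrite -wv fw mul0r !subr0 addr0.
(* If [O <= I] then [T = I] and all outgoing flow is removed; when [I = 0] there was none. Otherwise
   [T = O] and all incoming flow is removed. *)
- have [IO|OI] := leP O I.
  + left => y; rewrite fvv !mul0r if_same eqxx subr0 addr0.
    have [I_eq0|/eqP I_neq0] := eqVneq I 0.
      have : O = 0 by apply/eqP; rewrite eq_le O0 -I_eq0 IO.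
      by rewrite /O /outflow => /psumr_eq0P -> //; rewrite mul0r subr0.
    by rewrite /T max_l// divff ?mulr1 ?subrr//; exact/eqP.
  + right => x; rewrite fvv mulr0 !mul0r if_same eqxx subr0 addr0.
    rewrite /T max_r ?(ltW OI)// divff ?mulr1 ?subrr// gt_eqF//.
    exact: le_lt_trans OI.
Qed.

(** Induction over the vertices: clear the loops, then bypass the current vertex. Both operations
    keep earlier vertices pure. *)
Lemma reduces_pure f : (forall x y, 0 <= f x y) ->
  exists2 g, reduces f g & forall v, pure g v.
Proof.
move=> f0.
suff [g fg gp] : exists2 g, reduces f g & forall v, v \in enum X -> pure g v.
  by exists g => // v; apply: gp; rewrite mem_enum.
elim: (enum X) => [|v s [g fg gp]]; first by exists f.
have gl : reduces g (fun x y => if x == y then 0 else g x y).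
  by apply: reduces_loopless; case: fg.
set g' := (fun x y => _) in gl.
have [g'0 _ _ g'p] := gl.
have [gb bp] : reduces g' (bypass g' v) /\ pure (bypass g' v) v.
  by apply: reduces_bypass => //; rewrite /g' eqxx.
exists (bypass g' v).
  by apply: reduces_trans gb; exact: reduces_trans gl.
move=> w; rewrite inE => /predU1P[->//|/gp/g'p].
by case: gb => _ _ _; exact.
Qed.

(** In a pure flow the balance forces outflow and inflow to be the positive parts of [m0 - m1] and
    [m1 - m0]. The common mass [min(m0, m1)] stays on the diagonal at no cost. *)
Lemma coupling_of_flow (m0 m1 : X -> R) f :
  (forall x, 0 <= m0 x) -> (forall x, 0 <= m1 x) -> (forall x y, 0 <= f x y) ->
  (forall x, inflow f x - outflow f x = m1 x - m0 x) ->
  exists q, [/\ forall x y, 0 <= q x y,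
    forall x, \sum_y q x y = m0 x,
    forall y, \sum_x q x y = m1 y & cost q <= cost f].
Proof.
move=> m0_ge0 m1_ge0 f_ge0 fE.
have [g [g0 gE gC _] gp] := reduces_pure f_ge0.
pose m x := Num.min (m0 x) (m1 x).
have bal x : inflow g x - outflow g x = m1 x - m0 x by rewrite gE fE.
have in0 x : 0 <= inflow g x by apply: sumr_ge0.
have out0 x : 0 <= outflow g x by apply: sumr_ge0.
have mE x : outflow g x + m x = m0 x /\ inflow g x + m x = m1 x.
  rewrite /m; have := bal x; have := in0 x; have := out0 x.
  have [] : outflow g x = 0 \/ inflow g x = 0.
    by case: (gp x) => gx; [left|right]; apply: big1.
  - move=> ->; case: (leP (m0 x) (m1 x)) => ?; split; lra.
  - move=> ->; case: (leP (m0 x) (m1 x)) => ?; split; lra.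
exists (fun x y => g x y + if x == y then m x else 0); split.
- by move=> x y; rewrite addr_ge0//; case: ifP; rewrite // le_min m0_ge0 m1_ge0.
- move=> x; rewrite big_split/=; under [X in _ + X]eq_bigr do rewrite eq_sym.
  by rewrite -big_mkcond/= big_pred1_eq; exact: (mE x).1.
- move=> y; rewrite big_split/= -big_mkcond/= big_pred1_eq.
  exact: (mE y).2.
- apply: le_trans gC; rewrite le_eqVlt; apply/orP; left; apply/eqP.
  apply: eq_bigr => x _; apply: eq_bigr => y _.
  by case: eqP => [->|_]; rewrite ?d0 ?mul0r ?addr0.
Qed.

End flow.

(** * Graph distance *)

Section graph.
Context {R : realType} {X : finType}.
Variable K : X -> X -> R.

Lemma graph_dist_le_size x p : path (edge K) x p ->
  graph_dist K x (last x p) <= (size p)%:R.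
Proof.
move=> xp; apply: ge_inf; first by exists 0 => _ [q _ <-]; exact: ler0n.
by exists p.
Qed.

Lemma graph_dist_edge x y : edge K x y -> graph_dist K x y <= 1.
Proof. by move=> xy; apply: (@graph_dist_le_size x [:: y]); rewrite /= xy. Qed.

Hypothesis K_irr : irreducible K.

(** Irreducibility makes the set of path lengths nonempty, so that a lower bound of the set passes
    to its [inf]. *)
Lemma le_graph_dist x y a :
  (forall p, path (edge K) x p -> last x p = y -> a <= (size p)%:R) ->
  a <= graph_dist K x y.
Proof.
move=> axy; apply: lb_le_inf; last by move=> _ [p [xp py] <-]; exact: axy.
by have /connectP[p xp py] := K_irr x y; exists (size p)%:R, p.
Qed.

Lemma graph_dist_ge0 x y : 0 <= graph_dist K x y.
Proof. by apply: le_graph_dist => p _ _. Qed.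

Lemma graph_distxx x : graph_dist K x x = 0.
Proof.
apply/le_anti; rewrite graph_dist_ge0 andbT.
exact: (@graph_dist_le_size x [::]).
Qed.

Lemma graph_dist_triangle x y z :
  graph_dist K x z <= graph_dist K x y + graph_dist K y z.
Proof.
rewrite -lerBlDl; apply: le_graph_dist => q yq qz.
rewrite lerBlDl -lerBlDr; apply: le_graph_dist => p xp py.
rewrite lerBlDr -natrD -size_cat -qz -py -last_cat.
by apply: graph_dist_le_size; rewrite cat_path xp py.
Qed.

End graph.

(** * Logarithmic mean *)

Section logmean.
Context {R : realType}.
Implicit Types s t p : R.
Local Notation mu := (@lebesgue_measure R).

(** As the exponential of an affine function of [p], the integrand is easily differentiated and seen
    to be continuous. *)
Let geomE s t p : 0 < s -> 0 < t ->
  s `^ (1 - p) * t `^ p = expR (ln s + p * (ln t - ln s)).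
Proof.
by move=> s0 t0; rewrite /powR !gt_eqF// -expRD; congr expR; ring.
Qed.

Let geom_fun s t : 0 < s -> 0 < t ->
  (fun p => s `^ (1 - p) * t `^ p) = (fun p => expR (ln s + p * (ln t - ln s))).
Proof. by move=> s0 t0; apply/funext => p; exact: geomE. Qed.

Let is_derive_geom s t p : 0 < s -> 0 < t ->
  is_derive p 1 (fun p => s `^ (1 - p) * t `^ p)
    ((ln t - ln s) * (s `^ (1 - p) * t `^ p)).
Proof.
move=> s0 t0; rewrite geom_fun// geomE//.
have := @is_derive1_comp _ expR (fun p => ln s + p * (ln t - ln s)) p.
move=> /(_ _ (ln t - ln s) (is_derive_expR _)).
rewrite mulrC; apply; apply: trigger_derive; rewrite /GRing.scale/=; ring.
Qed.

Let continuous_geom s t : 0 < s -> 0 < t ->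
  continuous (fun p => s `^ (1 - p) * t `^ p).
Proof.
move=> s0 t0; rewrite geom_fun// => p.
apply: continuous_comp; last exact: continuous_expR.
by apply: cvgD; [exact: cvg_cst|apply: cvgMl; exact: cvg_id].
Qed.

Lemma logmean_pos s t : 0 < s -> 0 < t ->
  logmean s t = \int[mu]_(p in `[0, 1]) (s `^ (1 - p) * t `^ p).
Proof. by move=> s0 t0; rewrite /logmean !gt_eqF. Qed.

Lemma logmean_ge0 s t : 0 <= logmean s t.
Proof.
rewrite /logmean; case: ifP => // _.
by apply: Rintegral_ge0 => p _; rewrite mulr_ge0 ?powR_ge0.
Qed.

(** The substitution of [1 - p] for [p] exchanges the two arguments. *)
Lemma logmeanC s t : 0 <= s -> 0 <= t -> logmean s t = logmean t s.
Proof.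
rewrite !le_eqVlt => /predU1P[<-|s0]; first by rewrite /logmean eqxx orbT.
move=> /predU1P[<-|t0]; first by rewrite /logmean eqxx orbT.
rewrite !logmean_pos//.
rewrite (Rintegration_by_substitution_onem (r := 1)) ?ler01 ?lexx//.
  by rewrite onem1; apply: eq_Rintegral => p _; rewrite [1 - onem p]onemK mulrC.
by apply: continuous_subspaceT; exact: continuous_geom.
Qed.

Let integrable_geom s t : 0 < s -> 0 < t ->
  mu.-integrable `[0, 1] (EFin \o (fun p => s `^ (1 - p) * t `^ p)).
Proof.
move=> s0 t0; apply: continuous_compact_integrable.
  exact: segment_compact.
by apply: continuous_subspaceT; exact: continuous_geom.
Qed.

(** The tangent bound for [expR] gives [u >= G * (1 + ln u - ln G)]. Averaged over [u = s] and
    [u = t], the logarithms cancel, since [ln G] is their weighted mean. *)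
Lemma weighted_geom_le_arith s t p : 0 < s -> 0 < t -> 0 <= p <= 1 ->
  s `^ (1 - p) * t `^ p <= (1 - p) * s + p * t.
Proof.
move=> s0 t0 /andP[p0 p1].
set G := _ `^ _ * _; have G0 : 0 < G by rewrite mulr_gt0 ?powR_gt0.
have lG : ln G = (1 - p) * ln s + p * ln t.
  by rewrite lnM ?posrE ?powR_gt0// !ln_powR.
have H u : 0 < u -> G * (1 + (ln u - ln G)) <= u.
  move=> u0; have : G * expR (ln u - ln G) = u.
    by rewrite expRD expRN !lnK ?posrE// mulrC mulfVK ?gt_eqF.
  by move=> {2}<-; rewrite ler_pM2l// expR_ge1Dx.
have := ler_wpM2l p0 (H t t0).
have p1' : 0 <= 1 - p by lra.
have := ler_wpM2l p1' (H s s0).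
rewrite lG => h1 h2; apply: le_trans (lerD h1 h2).
by rewrite le_eqVlt; apply/orP; left; apply/eqP; ring.
Qed.

(** The weighted AM-GM inequality is integrated over [p]; the affine bound integrates to the
    midpoint. *)
Lemma logmean_le_mean s t : 0 <= s -> 0 <= t -> logmean s t <= (s + t) / 2.
Proof.
move=> s0 t0; rewrite /logmean; case: ifPn => [_|].
  by rewrite divr_ge0// addr_ge0.
rewrite negb_or => /andP[sn0 tn0].
have {}s0 : 0 < s by rewrite lt_def sn0.
have {}t0 : 0 < t by rewrite lt_def tn0.
have cA : continuous (fun p : R => (1 - p) * s + p * t).
  move=> p; apply: cvgD; apply: cvgMl; last exact: cvg_id.
  by apply: cvgB; [exact: cvg_cst|exact: cvg_id].
have iA : mu.-integrable `[0, 1] (EFin \o (fun p => (1 - p) * s + p * t)).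
  apply: continuous_compact_integrable; first exact: segment_compact.
  exact: continuous_subspaceT.
apply: (@le_trans _ _ (\int[mu]_(p in `[0, 1]) ((1 - p) * s + p * t))).
  apply: le_Rintegral => //=; first exact: integrable_geom.
  by move=> p; rewrite /= in_itv/=; exact: weighted_geom_le_arith.
pose F (p : R) := p * s + p ^+ 2 * ((t - s) / 2).
have dF p : is_derive p 1 F ((1 - p) * s + p * t).
  by apply: trigger_derive; rewrite /GRing.scale/=; field.
rewrite /Rintegral (@continuous_FTC2 _ _ F)//.
- by rewrite /F/=; lra.
- exact: continuous_subspaceT.
- split.
  + by move=> x _; case: (dF x).
  + apply: cvg_at_right_filter; apply: differentiable_continuous.
    by apply/derivable1_diffP; case: (dF 0).
  + apply: cvg_at_left_filter; apply: differentiable_continuous.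
    by apply/derivable1_diffP; case: (dF 1).
- by move=> x _; rewrite derive1E; case: (dF x).
Qed.

(* [(ln t - ln s) * ((ln t - ln s) ^+ 2) `^ (-1)] is the inverse of
   [ln t - ln s], written with a power because measurability is available for
   powers. *)
Lemma logmeanE s t : 0 <= s -> 0 <= t -> logmean s t =
  if (s == 0) || (t == 0) then 0 else
  if s == t then s else
  (t - s) * (ln t - ln s) * ((ln t - ln s) ^+ 2) `^ (-1).
Proof.
move=> s0 t0; rewrite /logmean; case: ifPn => [//|].
rewrite negb_or => /andP[sn0 tn0].
have {}s0 : 0 < s by rewrite lt_def sn0.
have {}t0 : 0 < t by rewrite lt_def tn0.
case: eqVneq => [<-|st].
  under eq_Rintegral do rewrite geomE// subrr mulr0 addr0 lnK ?posrE//.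
  rewrite Rintegral_cst//= lebesgue_measure_itv/= lte_fin ltr01 -EFinB/=.
  by rewrite subr0 mulr1.
have b0 : ln t - ln s != 0.
  by rewrite subr_eq0; apply: contra st => /eqP/ln_inj ->.
rewrite powR_inv1 ?sqr_ge0// -mulrA.
rewrite (_ : _ * _ ^-1 = (ln t - ln s)^-1); last by field.
pose F (p : R) := (ln t - ln s)^-1 *: (s `^ (1 - p) * t `^ p : R^o).
have dF p : is_derive p 1 F (s `^ (1 - p) * t `^ p).
  have := is_deriveZ (ln t - ln s)^-1 (is_derive_geom p s0 t0).
  by rewrite [_ *: _]mulrA mulVf// mul1r.
rewrite /Rintegral (@continuous_FTC2 _ _ F)//.
- rewrite /F/= subr0 subrr !powRr1 ?powRr0 ?ltW// mul1r mulr1.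
  by rewrite /GRing.scale/= -mulrBr mulrC.
- by apply: continuous_subspaceT; exact: continuous_geom.
- split.
  + by move=> x _; case: (dF x).
  + apply: cvg_at_right_filter; apply: differentiable_continuous.
    by apply/derivable1_diffP; case: (dF 0).
  + apply: cvg_at_left_filter; apply: differentiable_continuous.
    by apply/derivable1_diffP; case: (dF 1).
- by move=> x _; rewrite derive1E; case: (dF x).
Qed.

(** The closed form replaces a parametric integral by case distinctions, logarithms and powers. *)
Lemma measurable_logmean d (T : measurableType d) (D : set T) (u v : T -> R) :
  measurable D -> measurable_fun D u -> measurable_fun D v ->
  (forall x, D x -> 0 <= u x) -> (forall x, D x -> 0 <= v x) ->
  measurable_fun D (fun x => logmean (u x) (v x)).
Proof.
move=> mD mu_ mv u0 v0.
pose g x := if (u x == 0) || (v x == 0) then 0 else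
  if u x == v x then u x else
  (v x - u x) * (ln (v x) - ln (u x)) * ((ln (v x) - ln (u x)) ^+ 2) `^ (-1).
apply: (eq_measurable_fun g).
  by move=> x /set_mem Dx; rewrite logmeanE ?u0 ?v0.
have mlu : measurable_fun D (fun x => ln (v x) - ln (u x)).
  by apply: measurable_funB; exact: measurableT_comp.
apply: measurable_fun_if => //.
- apply: measurable_or; apply: measurable_fun_eqr => //;
    exact: measurable_cst.
- apply: (@measurable_funS _ _ _ _ D) => //.
  apply: measurable_fun_if => //; first exact: measurable_fun_eqr.
  + exact: (@measurable_funS _ _ _ _ D).
  + apply: (@measurable_funS _ _ _ _ D) => //.
    apply: measurable_funM.
      by apply: measurable_funM => //; exact: measurable_funB.
    exact: (measurableT_comp (f := @powR R ^~ (-1)) (measurable_powR _)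
      (measurable_funX 2 mlu)).
Qed.

End logmean.

(** * Curves and couplings *)

Lemma Rintegral_sum d (T : measurableType d) (R : realType)
    (mu : {measure set T -> \bar R}) (D : set T) (I : Type) (s : seq I)
    (f : I -> T -> R) : measurable D ->
  (forall i, mu.-integrable D (EFin \o f i)) ->
  \int[mu]_(x in D) (\sum_(i <- s) f i x) =
  \sum_(i <- s) \int[mu]_(x in D) f i x.
Proof.
move=> mD fi; have sumi (s' : seq I) :
    mu.-integrable D (EFin \o (fun x => \sum_(i <- s') f i x)).
  rewrite (_ : _ \o _ = fun x => (\sum_(i <- s') (f i x)%:E)%E).
    by apply: integrable_sum => // i _; exact: fi.
  by apply/funext => x; rewrite /= sumEFin.
elim: s => [|i s IH].
  under eq_Rintegral do rewrite big_nil.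
  by rewrite big_nil Rintegral_cst// mul0r.
by under eq_Rintegral do rewrite big_cons; rewrite big_cons RintegralD// IH.
Qed.

(** On the open interval [derive1 f] agrees with the continuous extension [g 1], which is integrable
    on [[0, 1]]. The endpoints, where [derive1 f] would see values of [f] outside [[0, 1]], form a
    null set. *)
Lemma smooth01_FTC (R : realType) (f : R -> R) : smooth01 f ->
  [/\ {within `[0, 1], continuous f},
      (@lebesgue_measure R).-integrable `]0, 1[ (EFin \o derive1 f) &
      \int[@lebesgue_measure R]_(t in `]0, 1[) derive1 f t = f 1 - f 0].
Proof.
move=> [g [g0 gP]]; have [f_cont f_der] := gP 0%N; have [g1_cont _] := gP 1%N.
rewrite g0 in f_cont f_der.
have f'E (t : R) : t \in `]0, 1[ -> derive1 f t = g 1%N t.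
  by move=> t01; rewrite derive1E; case: (f_der t t01).
have g1i : (@lebesgue_measure R).-integrable `[0, 1] (EFin \o g 1%N).
  by apply: continuous_compact_integrable => //; exact: segment_compact.
have g1i' : (@lebesgue_measure R).-integrable `]0, 1[ (EFin \o g 1%N).
  by apply: integrableS g1i => //; exact: subset_itv_oo_cc.
split => //.
  apply: eq_integrable g1i' => // t /set_mem t01.
  by rewrite /= f'E.
have -> : \int[@lebesgue_measure R]_(t in `]0, 1[) derive1 f t =
    \int[@lebesgue_measure R]_(t in `]0, 1[) g 1%N t.
  by apply: eq_Rintegral => t /set_mem t01; rewrite f'E.
rewrite Rintegral_itv_bndo_bndc// Rintegral_itv_obnd_cbnd//; last first.
  by apply: integrableS g1i => //; exact: subset_itv_oc_cc.
rewrite /Rintegral (continuous_FTC2 (F := f))//.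
have [_ f0 f1] := (continuous_within_itvP f (@ltr01 R)).1 f_cont.
by split => // t t01; case: (f_der t t01).
Qed.

Section curve.
Context {R : realType} {X : finType} (K : X -> X -> R) (pi : X -> R).
Hypotheses (K_markov : markov_kernel K) (K_irr : irreducible K)
  (pi_prob : probability_measure pi) (K_rev : reversible K pi).
Variables (r0 r1 : X -> R) (rho psi : R -> X -> R).
Hypothesis curve : admissible_curve K pi r0 r1 rho psi.
Local Notation mu := (@lebesgue_measure R).
Local Notation D := (`[0, 1]%classic : set R).

Let mD : measurable D. Proof. exact: measurable_itv. Qed.

(** * Edge weights, currents and energies along a curve *)

Let weight t x y := rhohat (rho t) x y * K x y * pi x.
Let current t x y := (psi t y - psi t x) * weight t x y.
Let energy t x y := (psi t y - psi t x) ^+ 2 * weight t x y.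

Let K_ge0 x y : 0 <= K x y. Proof. by case: K_markov. Qed.
Let pi_ge0 x : 0 <= pi x. Proof. by case: pi_prob. Qed.
Let rho_ge0 t x : D t -> 0 <= rho t x.
Proof. by move=> Dt; case: curve => _ /(_ _ Dt)[]. Qed.

Let weight_ge0 t x y : 0 <= weight t x y.
Proof. by rewrite /weight mulr_ge0// mulr_ge0// logmean_ge0. Qed.

Let weightC t x y : D t -> weight t x y = weight t y x.
Proof.
move=> Dt; rewrite /weight -!mulrA K_rev; congr (_ * _).
by rewrite /rhohat logmeanC// rho_ge0.
Qed.

(** The arithmetic mean bounds the logarithmic one. By reversibility its two halves are the same sum
    with [x] and [y] exchanged, and each full sum is the total mass of [rho t]. *)
Let sum_weight_le1 t : D t -> \sum_x \sum_y weight t x y <= 1.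
Proof.
move=> Dt; have [_ /(_ _ Dt)[_ rho1] _ _ _] := curve.
have le x y : weight t x y <=
    2^-1 * (rho t x * K x y * pi x) + 2^-1 * (rho t y * K y x * pi y).
  rewrite /weight -!mulrA -(K_rev x y).
  have Kpi : 0 <= K x y * pi x by rewrite mulr_ge0.
  have := ler_wpM2r Kpi (logmean_le_mean (rho_ge0 x Dt) (rho_ge0 y Dt)).
  by rewrite mulrAC mulrDl mulrDl ![_ * 2^-1]mulrC.
have E : \sum_x \sum_y (rho t x * K x y * pi x) = 1.
  rewrite -rho1; apply: eq_bigr => x _; rewrite -mulr_suml -mulr_sumr.
  by case: K_markov => _ ->; rewrite mulr1 mulrC.
apply: (@le_trans _ _ (\sum_x \sum_y
    (2^-1 * (rho t x * K x y * pi x) + 2^-1 * (rho t y * K y x * pi y)))).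
  by apply: ler_sum => x _; apply: ler_sum => y _.
under eq_bigr do rewrite big_split/= -!mulr_sumr.
rewrite big_split/= -!mulr_sumr [X in _ + _ * X]exchange_big/= E; lra.
Qed.

Let weight_le1 t x y : D t -> weight t x y <= 1.
Proof.
move=> Dt; apply: le_trans (sum_weight_le1 Dt).
rewrite (bigD1 x)//= (bigD1 y)//= -addrA lerDl addr_ge0//.
  by apply: sumr_ge0.
by apply: sumr_ge0 => i _; apply: sumr_ge0.
Qed.

Let measurable_weight x y : measurable_fun D (fun t => weight t x y).
Proof.
have mrho z : measurable_fun D (fun t => rho t z).
  have [/(_ z)/smooth01_FTC[+ _ _] _ _ _ _] := curve.
  exact: subspace_continuous_measurable_fun.
apply: measurable_funM => //; apply: measurable_funM => //.
by apply: measurable_logmean => // t; exact: rho_ge0.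
Qed.

Let measurable_psiB x y : measurable_fun D (fun t => psi t y - psi t x).
Proof. by apply: measurable_funB; case: curve. Qed.

Let integrable_weight x y : mu.-integrable D (EFin \o (fun t => weight t x y)).
Proof.
apply: measurable_bounded_integrable => //.
  by apply: compact_finite_measure; exact: segment_compact.
  exact: measurable_weight.
exists 1; split; first exact: num_real.
move=> M M1 t Dt; rewrite /= ger0_norm//.
by apply: le_trans (ltW M1); exact: weight_le1.
Qed.

(** * Integrability and pointwise bounds from a bound on the action *)

Variable a : R.
(** Positivity makes [s] below invertible; a curve of zero action is covered by any positive
    bound. *)
Hypothesis a_gt0 : 0 < a.
Hypothesis action_le : (action K pi rho psi <= a%:E)%E.

Let actionE t : 2^-1 * \sum_x \sum_y
    (psi t y - psi t x) ^+ 2 * rhohat (rho t) x y * K x y * pi x =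
  2^-1 * \sum_x \sum_y energy t x y.
Proof.
congr (_ * _); apply: eq_bigr => x _; apply: eq_bigr => y _.
by rewrite /energy /weight !mulrA.
Qed.

Let energy_ge0 t x y : 0 <= energy t x y.
Proof. by rewrite /energy mulr_ge0// sqr_ge0. Qed.

Let measurable_energy x y : measurable_fun D (fun t => energy t x y).
Proof. by apply: measurable_funM => //; exact: measurable_funX. Qed.

Let total t := \sum_x \sum_y energy t x y.

Let total_ge0 t : 0 <= total t.
Proof. by apply: sumr_ge0 => x _; apply: sumr_ge0. Qed.

(** The function is nonnegative, so the integral of its norm is the action itself, which is
    finite. *)
Let integrable_total : mu.-integrable D (EFin \o (fun t => 2^-1 * total t)).
Proof.
apply/integrableP; split.
  apply/measurable_EFinP; apply: measurable_funM => //.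
  apply: measurable_sum => x; apply: measurable_sum => y.
  exact: measurable_energy.
apply: (@le_lt_trans _ _ a%:E); last exact: ltry.
apply: le_trans action_le.
rewrite /action le_eqVlt; apply/orP; left; apply/eqP.
apply: eq_integral => t _; rewrite /= ger0_norm ?mulr_ge0 ?invr_ge0//.
by rewrite actionE.
Qed.

Let total_le : \int[mu]_(t in D) (2^-1 * total t) <= a.
Proof.
rewrite -lee_fin /Rintegral fineK.
  apply: le_trans action_le.
  rewrite /action le_eqVlt; apply/orP; left; apply/eqP.
  by apply: eq_integral => t _; rewrite actionE.
exact: integrable_fin_num.
Qed.

Let energy_le_total t x y : energy t x y <= total t.
Proof.
rewrite /total (bigD1 x)//= (bigD1 y)//= -addrA lerDl addr_ge0//.
  by apply: sumr_ge0.
by apply: sumr_ge0 => i _; apply: sumr_ge0.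
Qed.

Let integrable_energy x y : mu.-integrable D (EFin \o (fun t => energy t x y)).
Proof.
have h : mu.-integrable D (fun t =>
    2%:E * (EFin \o (fun t => 2^-1 * total t)%R) t)%E by exact: integrableZl.
apply: le_integrable h => //.
  by apply/measurable_EFinP; exact: measurable_energy.
move=> t Dt; rewrite /= lee_fin mulVKf//.
by rewrite !ger0_norm// energy_le_total.
Qed.

(* This value of [s] makes the two terms of the AM-GM bound
   [norm_current_le] contribute equally. *)
Let s := 2 * Num.sqrt (a / 2).
Let s_gt0 : 0 < s. Proof. by rewrite mulr_gt0// sqrtr_gt0 divr_gt0. Qed.

(** Expanding [(u - s) ^+ 2 >= 0] gives [u <= u ^+ 2 / (2 * s) + s / 2], here with [u] the norm of
    the gradient of [psi]. With a good [s] this does the work of Cauchy-Schwarz while staying linear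
    in energy and weight. *)
Let norm_current_le t x y :
  `|current t x y| <= (2 * s)^-1 * energy t x y + s / 2 * weight t x y.
Proof.
rewrite /current /energy normrM (ger0_norm (weight_ge0 _ _ _)).
rewrite [(2 * s)^-1 * _]mulrA -mulrDl.
rewrite ler_wpM2r// -real_normK ?num_real//.
have -> : (2 * s)^-1 * `|psi t y - psi t x| ^+ 2 + s / 2 =
    (2 * s)^-1 * ((`|psi t y - psi t x| - s) ^+ 2) + `|psi t y - psi t x|.
  by field; rewrite gt_eqF.
by rewrite lerDr mulr_ge0 ?sqr_ge0// invr_ge0 mulr_ge0// ltW.
Qed.

Let integrable_bound x y : mu.-integrable D
  (EFin \o (fun t => (2 * s)^-1 * energy t x y + s / 2 * weight t x y)).
Proof.
rewrite (_ : _ \o _ = (fun t =>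
   ((2 * s)^-1)%:E * (EFin \o (fun t => energy t x y)) t
   + (s / 2)%:E * (EFin \o (fun t => weight t x y)) t)%E)//.
by apply: integrableD => //; exact: integrableZl.
Qed.

Let integrable_current x y :
  mu.-integrable D (EFin \o (fun t => current t x y)).
Proof.
apply: le_integrable (integrable_bound x y) => //.
  by apply/measurable_EFinP; apply: measurable_funM;
    [exact: measurable_psiB|exact: measurable_weight].
move=> t Dt; rewrite /= lee_fin; apply: le_trans (norm_current_le _ _ _) _.
exact: ler_norm.
Qed.

(** * Net flux over the whole time interval and the flow it induces *)

Let flux x y := \int[mu]_(t in D) current t x y.

Let fluxC x y : flux y x = - flux x y.
Proof.
rewrite -mulN1r -RintegralZl//; apply: eq_Rintegral => t /set_mem Dt.
by rewrite /current weightC// mulN1r -mulNr opprB.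
Qed.

(** This is the continuity equation multiplied by [pi x] and integrated in time, over the open
    interval because the equation is given only there. *)
Let sum_flux x : \sum_y flux x y = - ((r1 x - r0 x) * pi x).
Proof.
have [/(_ x)/smooth01_FTC[_ rho'i rho'E] _ [rho0 rho1] _ cont_eq] := curve.
have sub : `]0, 1[%classic `<=` D by exact: subset_itv_oo_cc.
have -> : \sum_y flux x y = \int[mu]_(t in `]0, 1[) (\sum_y current t x y).
  rewrite Rintegral_sum//; last first.
    by move=> y; apply: integrableS (integrable_current x y).
  apply: eq_bigr => y _; rewrite /flux -Rintegral_itv_bndo_bndc//.
    rewrite Rintegral_itv_obnd_cbnd//.
    exact: integrableS (integrable_current x y).
  by apply: integrableS (integrable_current x y) => //; exact: subset_itv_co_cc.
rewrite -rho0 -rho1 -rho'E mulrC -mulNr -RintegralZl//.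
apply: eq_Rintegral => t /set_mem Dt.
have /eqP := cont_eq t x Dt; rewrite addr_eq0 => /eqP ->.
rewrite mulrN mulNr opprK mulr_sumr; apply: eq_bigr => y _.
by rewrite /current /weight [RHS]mulrC !mulrA.
Qed.

(** The positive part of the flux: by antisymmetry [flow x y - flow y x = flux x y], so the net
    balance is kept. *)
Let flow x y := (`|flux x y| + flux x y) / 2.

Let flow_ge0 x y : 0 <= flow x y.
Proof. by rewrite divr_ge0// -lerBlDr sub0r -normrN ler_norm. Qed.

Let flow_balance x : inflow flow x - outflow flow x = r1 x * pi x - r0 x * pi x.
Proof.
rewrite /inflow /outflow -sumrB -mulrBl -[RHS]opprK -sum_flux -sumrN.
by apply: eq_bigr => y _; rewrite /flow (fluxC x y) normrN; lra.
Qed.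

(** The energies integrate to at most [2 * a], the action carrying a factor one half, and the
    weights to at most [1]. The bound [a / s + s / 2] then equals the right-hand side. *)
Let sum_norm_flux : \sum_x \sum_y `|flux x y| <= 2 * Num.sqrt (a / 2).
Proof.
apply: (@le_trans _ _ (\sum_x \sum_y
    ((2 * s)^-1 * \int[mu]_(t in D) energy t x y
    + s / 2 * \int[mu]_(t in D) weight t x y))).
  apply: ler_sum => x _; apply: ler_sum => y _.
  have scaled c (g : R -> R) : mu.-integrable D (EFin \o g) ->
      mu.-integrable D (EFin \o (fun t => c * g t)).
    by move=> gi; exact: (@integrableZl _ _ _ mu _ mD c _ gi).
  rewrite -!RintegralZl// -RintegralD//; [|exact: scaled..].
  apply: le_trans (le_normr_Rintegral _ _) _ => //.
  apply: le_Rintegral => //.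
  exact: (@integrable_norm _ _ _ mu).
under eq_bigr do rewrite big_split/= -!mulr_sumr -!Rintegral_sum//.
have isum (g : R -> X -> X -> R) x :
    (forall x y, mu.-integrable D (EFin \o (fun t => g t x y))) ->
    mu.-integrable D (EFin \o (fun t => \sum_y g t x y)).
  move=> gi; rewrite (_ : _ \o _ = fun t => (\sum_y (g t x y)%:E)%E).
    by apply: integrable_sum => // y _; exact: gi.
  by apply/funext => t; rewrite /= sumEFin.
have isum2 (g : R -> X -> X -> R) :
    (forall x y, mu.-integrable D (EFin \o (fun t => g t x y))) ->
    mu.-integrable D (EFin \o (fun t => \sum_x \sum_y g t x y)).
  move=> gi; rewrite (_ : _ \o _ = fun t => (\sum_x (\sum_y g t x y)%:E)%E).
    by apply: integrable_sum => // x _; exact: isum.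
  by apply/funext => t; rewrite /= sumEFin.
have exchange (g : R -> X -> X -> R) :
    (forall x y, mu.-integrable D (EFin \o (fun t => g t x y))) ->
    \sum_x \int[mu]_(t in D) (\sum_y g t x y) =
    \int[mu]_(t in D) (\sum_x \sum_y g t x y).
  by move=> gi; rewrite Rintegral_sum// => x; apply: (isum g).
rewrite big_split/= -!mulr_sumr (exchange energy)// (exchange weight)//.
have He : \int[mu]_(t in D) (\sum_x \sum_y energy t x y) <= 2 * a.
  have := total_le; rewrite RintegralZl//; [lra|exact: (isum2 energy)].
have Hw : \int[mu]_(t in D) (\sum_x \sum_y weight t x y) <= 1.
  have D1 : \int[mu]_(t in D) (1 : R) = 1.
    rewrite Rintegral_cst//= lebesgue_measure_itv/= lte_fin ltr01 -EFinB/=.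
    by rewrite subr0 mulr1.
  rewrite -[leRHS]D1; apply: le_Rintegral => //; first exact: (isum2 weight).
  apply: continuous_compact_integrable; first exact: segment_compact.
  by apply: continuous_subspaceT => ?; exact: cvg_cst.
set z := Num.sqrt _.
have z2 : z ^+ 2 = a / 2 by rewrite sqr_sqrtr// divr_ge0// ltW.
have z0 : 0 < z by rewrite sqrtr_gt0 divr_gt0.
apply: (@le_trans _ _ ((2 * s)^-1 * (2 * a) + s / 2 * 1)).
  by rewrite lerD// ler_wpM2l// ?invr_ge0 ?divr_ge0 ?mulr_ge0// ltW.
rewrite /s -/z (_ : a = 2 * z ^+ 2); last by rewrite z2; field.
by rewrite le_eqVlt; apply/orP; left; apply/eqP; field; rewrite gt_eqF.
Qed.

(** The signed fluxes cancel in pairs, leaving half the sum of the norms. *)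
Let sum_flow : \sum_x \sum_y flow x y <= Num.sqrt (a / 2).
Proof.
have -> : \sum_x \sum_y flow x y =
    (\sum_x \sum_y `|flux x y|) / 2 + (\sum_x \sum_y flux x y) / 2.
  rewrite -mulrDl -big_split/= mulr_suml; apply: eq_bigr => x _.
  by rewrite -big_split/= mulr_suml.
have : \sum_x \sum_y flux x y = - \sum_x \sum_y flux x y.
  rewrite [LHS]exchange_big/= -sumrN; apply: eq_bigr => x _.
  by rewrite -sumrN; apply: eq_bigr => y _.
by have := sum_norm_flux; lra.
Qed.

Lemma coupling_of_curve : exists2 q, coupling pi r0 r1 q &
  \sum_x \sum_y graph_dist K x y * q x y <= Num.sqrt (a / 2).
Proof.
have [_ _ [rho0 rho1] _ _] := curve.
have r0_ge0 x : 0 <= r0 x by rewrite -rho0 rho_ge0//= in_itv/= lexx ler01.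
have r1_ge0 x : 0 <= r1 x by rewrite -rho1 rho_ge0//= in_itv/= lexx ler01.
have [q [q0 q1 q2 qC]] := coupling_of_flow (graph_distxx K_irr)
  (graph_dist_triangle K_irr)
  (fun x => mulr_ge0 (r0_ge0 x) (pi_ge0 x))
  (fun x => mulr_ge0 (r1_ge0 x) (pi_ge0 x)) flow_ge0 flow_balance.
exists q => //; apply: le_trans qC _; apply: le_trans sum_flow.
apply: ler_sum => x _; apply: ler_sum => y _.
(* On an edge the distance is at most [1]; elsewhere [K x y = 0], so no mass flows. Hence the cost
   is at most the total flow. *)
have [xy|] := boolP (edge K x y).
  by rewrite ler_piMl// graph_dist_edge.
rewrite /edge lt_neqAle K_ge0 andbT negbK => /eqP Kxy.
suff -> : flow x y = 0 by rewrite mulr0.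
have -> : flow x y = (`|flux x y| + flux x y) / 2 by [].
suff -> : flux x y = 0 by rewrite normr0 addr0 mul0r.
rewrite /flux; under eq_Rintegral => t _.
  rewrite /current /weight -Kxy mulr0 mul0r mulr0; over.
by rewrite Rintegral_cst// mul0r.
Qed.

End curve.

(** * Transport and concentration inequalities *)

Section consequences.
Context {R : realType} {X : finType} (K : X -> X -> R) (pi : X -> R).
Hypothesis pi_prob : probability_measure pi.

Let pi_ge0 x : 0 <= pi x. Proof. by case: pi_prob. Qed.

(** Termwise [r * ln r >= r - 1], and the mean of [r - 1] under [pi] vanishes. *)
Lemma entropy_ge0 r : density pi r -> 0 <= entropy pi r.
Proof.
case: pi_prob => _ pi1 [r0 r1].
have -> : 0 = \sum_x (pi x * r x - pi x) by rewrite sumrB r1 pi1 subrr.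
apply: ler_sum => x _; have [rx0|rx0] := eqVneq (r x) 0.
  by rewrite rx0 mulr0 mul0r sub0r oppr_le0.
have {}rx0 : 0 < r x by rewrite lt_def rx0 r0.
rewrite -mulrA -{2}[pi x]mulr1 -mulrBr ler_wpM2l//.
have : ln (1 + ((r x)^-1 - 1)) <= (r x)^-1 - 1.
  by apply: le_ln1Dx; rewrite ltrBDl subrr invr_gt0.
rewrite addrC subrK lnV ?posrE// => /(ler_wpM2l (ltW rx0)).
by rewrite mulrN mulrBr divff ?gt_eqF// mulr1; lra.
Qed.

(** The easy half of Kantorovich-Rubinstein duality: both means are written as sums against the same
    coupling. *)
Lemma expectation_gap_le_W1g phi r0 r1 : lipschitz1 K phi ->
  ((\sum_x phi x * (r0 x * pi x) - \sum_x phi x * (r1 x * pi x))%:E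
    <= dist_W1g K pi r0 r1)%E.
Proof.
move=> lip; apply: le_ereal_inf_tmp => _ [q [q0 qr0 qr1] <-]; rewrite lee_fin.
have -> : \sum_x phi x * (r0 x * pi x) = \sum_x \sum_y phi x * q x y.
  by apply: eq_bigr => x _; rewrite -mulr_sumr qr0.
have -> : \sum_x phi x * (r1 x * pi x) = \sum_x \sum_y phi y * q x y.
  by rewrite exchange_big; apply: eq_bigr => y _; rewrite -mulr_sumr qr1.
rewrite -sumrB; apply: ler_sum => x _; rewrite -sumrB; apply: ler_sum => y _.
by rewrite -mulrBl ler_wpM2r//; apply: le_trans (lip x y); exact: ler_norm.
Qed.

(* The Bobkov--Goetze argument: the transport bound is tested on the Gibbs
   density [expR (t * phi) / Z]. *)
Lemma laplace_le lambda phi t : 0 < lambda -> 0 < t ->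
  (forall r, density pi r ->
    \sum_x phi x * (r x * pi x) - expect pi phi <=
    Num.sqrt (1 / lambda * entropy pi r)) ->
  expect pi (fun x => expR (t * (phi x - expect pi phi))) <=
  expR (t ^+ 2 / (4 * lambda)).
Proof.
move=> lambda0 t0 gap; set m := expect pi phi.
have [_ pi1] := pi_prob.
pose Z := \sum_x expR (t * phi x) * pi x.
have summand_ge0 x : 0 <= expR (t * phi x) * pi x by rewrite mulr_ge0 ?expR_ge0.
have Z0 : 0 < Z.
  rewrite lt_def sumr_ge0// andbT; apply/eqP => /psumr_eq0P Z0.
  have : \sum_x pi x = 0.
    apply: big1 => x _; have /eqP := Z0 (fun x _ => summand_ge0 x) x isT.
    by rewrite mulf_eq0 gt_eqF ?expR_gt0//= => /eqP.
  by rewrite pi1 => /eqP; rewrite oner_eq0.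
pose r x := expR (t * phi x) / Z.
have sum_r : \sum_x r x * pi x = 1.
  rewrite -(divff (lt0r_neq0 Z0)) {1}/Z mulr_suml.
  by apply: eq_bigr => x _; rewrite /r mulrAC.
have r_density : density pi r.
  split=> [x|]; first by rewrite divr_ge0 ?expR_ge0// ltW.
  by rewrite -sum_r; apply: eq_bigr => x _; rewrite mulrC.
set E := \sum_x phi x * (r x * pi x) in gap.
(* The equality case of the Gibbs variational principle, from [ln (r x) = t * phi x - ln Z]. *)
have entropyE : entropy pi r = t * E - ln Z.
  rewrite /entropy /E mulr_sumr -[ln Z]mul1r -sum_r mulr_suml -sumrB.
  apply: eq_bigr => x _.
  by rewrite /r ln_div ?posrE ?expR_gt0// expRK -/(r x); ring.
have -> : expect pi (fun x => expR (t * (phi x - m))) = expR (ln Z - t * m).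
  rewrite expRD lnK ?posrE// /expect mulr_suml; apply: eq_bigr => x _.
  by rewrite mulrBr expRD mulrAC.
rewrite ler_expR; have := gap _ r_density; rewrite -/E -/m.
set H := entropy pi r; have H0 : 0 <= H by exact: entropy_ge0.
rewrite mul1r [_^-1 * _]mulrC.
set w := Num.sqrt _ => gap_w.
have w2 : w ^+ 2 * lambda = H.
  by rewrite /w sqr_sqrtr; [field; rewrite gt_eqF|rewrite divr_ge0// ltW].
have -> : ln Z - t * m = t * (E - m) - H by rewrite /H entropyE; ring.
apply: (@le_trans _ _ (t * w - H)); first by rewrite lerB// ler_pM2l.
(* Completing the square: [t * w - lambda * w ^+ 2] is largest at [w = t / (2 * lambda)], with value
   [t ^+ 2 / (4 * lambda)]. *)
rewrite -w2 -subr_ge0 (_ : _ - _ = lambda * (w - t / (2 * lambda)) ^+ 2).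
  by rewrite mulr_ge0 ?sqr_ge0// ltW.
by field; rewrite gt_eqF.
Qed.

(** The infimum over curves need not be attained. The slack [e] yields a curve of action below
    [2 * z ^+ 2], hence a coupling of cost at most [z]. *)
Lemma dist_W1g_le_dist_W r0 r1 h : markov_kernel K -> irreducible K ->
  reversible K pi -> 0 <= h ->
  (dist_W K pi r0 r1 <= (Num.sqrt h)%:E)%E ->
  (dist_W1g K pi r0 r1 <= (Num.sqrt (h / 2))%:E)%E.
Proof.
move=> K_markov K_irr K_rev h0.
rewrite /dist_W -[(Num.sqrt h)%:E]/(sqrte h%:E) lee_sqrt ?lee_fin// => inf_le.
apply/lee_addgt0Pr => e e0; rewrite -EFinD.
set z := Num.sqrt (h / 2) + e.
have z0 : 0 < z by rewrite ltr_wpDl ?sqrtr_ge0.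
have hz : h < 2 * z ^+ 2.
  rewrite -ltr_pdivrMl// mulrC -[X in X < _]sqr_sqrtr ?divr_ge0//.
  by rewrite ltr_pXn2r ?nnegrE ?sqrtr_ge0 ?(ltW z0)// ltrDl.
have [_ [[rho psi] /= curve <-] action_lt] : exists2 y,
    [set action K pi c.1 c.2 |
      c in [set c | admissible_curve K pi r0 r1 c.1 c.2]] y &
    (y < (2 * z ^+ 2)%:E)%E.
  by apply: ereal_inf_lt; apply: le_lt_trans inf_le _; rewrite lte_fin.
have a0 : 0 < 2 * z ^+ 2 by rewrite mulr_gt0// exprn_gt0.
have [q qc] := coupling_of_curve K_markov K_irr pi_prob K_rev curve a0
  (ltW action_lt).
rewrite mulrAC divff// mul1r sqrtr_sqr gtr0_norm// => q_le.
apply: ge_ereal_inf; exists (\sum_x \sum_y graph_dist K x y * q x y)%:E.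
  by exists q.
by rewrite lee_fin.
Qed.

End consequences.

Theorem proposition7p7 (R : realType) (X : finType) (K : X -> X -> R)
    (pi : X -> R) (lambda : R)
    (K_markov : markov_kernel K) (K_irr : irreducible K)
    (pi_prob : probability_measure pi) (pi_stat : stationary K pi)
    (K_rev : reversible K pi) (lambda_gt0 : 0 < lambda)
    (talagrand : modified_talagrand K pi lambda) :
  (forall r : X -> R, density pi r ->
     (dist_W1g K pi r (fun=> 1%R)
        <= (Num.sqrt (1 / lambda * entropy pi r))%:E)%E)
  /\
  (forall (t : R) (phi : X -> R), 0 < t -> lipschitz1 K phi ->
     expect pi (fun x => expR (t * (phi x - expect pi phi)))
       <= expR (t ^+ 2 / (4 * lambda))).
Proof.
have W1g_le r : density pi r -> (dist_W1g K pi r (fun=> 1%R)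
    <= (Num.sqrt (1 / lambda * entropy pi r))%:E)%E.
  move=> dr.
  rewrite (_ : 1 / lambda * entropy pi r = 2 / lambda * entropy pi r / 2).
    apply: dist_W1g_le_dist_W => //; last exact: talagrand.
    by rewrite mulr_ge0 ?entropy_ge0// divr_ge0// ltW.
  by field; rewrite gt_eqF.
split=> // t phi t_gt0 lip; apply: laplace_le => // r dr.
(* By duality the transport inequality bounds the gap between the means of [phi] under [r] and under
   the density [1]. *)
rewrite -lee_fin; apply: le_trans (W1g_le r dr).
apply: le_trans (expectation_gap_le_W1g pi r (fun=> 1) lip).
rewrite lee_fin le_eqVlt; apply/orP; left; apply/eqP; congr (_ - _).
by apply: eq_bigr => x _; rewrite mul1r.
Qed.
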